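(* Let $G$ be a finite fully regular graph with parameters $a_0,a_1,\dots,a_\alpha$, where $\alpha=\alpha(G)$ is the size of a largest independent set of $G$. Then $$\sigma'(G)=\sum_{i=0}^{\alpha}\prod_{j=1}^i\frac{-a_j}{a_0-a_j},\qquad \sigma(G)=a_0!\sum_{i=0}^{\alpha}\prod_{j=1}^i\frac{-a_j}{a_0-a_j}.$$
   Context: A linear ordering $\pi:V(G)\to\{1,\dots,|V(G)|\}$ of the vertices of a graph $G$ is called successive if for every $i\ge 1$ the subgraph of $G$ induced by $\{v:\pi(v)\le i\}$ is connected. $\sigma(G)$ denotes the number of successive orderings of $V(G)$ and $\sigma'(G)=\sigma(G)/|V(G)|!$ is the probability that a uniformly random linear ordering is successive. A graph $G$ is fully regular if there are numbers $a_0,a_1,\dots,a_{\alpha(G)}$ (its parameters) such that for every independent set $I\subseteq V(G)$, the number of vertices in $V(G)\setminus I$ not adjacent to any element of $I$ equals $a_{|I|}$; thus $a_0=|V(G)|$ and $a_{\alpha(G)}=0$. Empty products are equal to $1$. *)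

(* Defs.v *)
From mathcomp Require Import all_boot all_order all_algebra.

Set Implicit Arguments.
Unset Strict Implicit.
Unset Printing Implicit Defensive.

(* A finite simple graph is a finType T of vertices with a symmetric and
   irreflexive adjacency relation e : rel T. *)
Section Graphs.
Variables (T : finType) (e : rel T).

Definition induced (S : {set T}) : rel T :=
  [rel x y | [&& x \in S, y \in S & e x y]].

(* The empty subgraph counts as connected; this convention is only ever
   relevant when T is empty. *)
Definition induced_connected (S : {set T}) : bool :=
  [forall x in S, forall y in S, connect (induced S) x y].

(* 'I_#|T| is 0-based, so the position of v in {1, ..., |V|} is (p v).+1.
   An injective p : T -> 'I_#|T| is a bijection. *)
Definition initial_segment (p : {ffun T -> 'I_#|T|}) (i : nat) : {set T} :=
  [set v | (p v).+1 <= i].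

Definition linear_ordering (p : {ffun T -> 'I_#|T|}) : bool := injectiveb p.

(* For i > #|T| the initial segment is the same as for i = #|T|;
   see successiveP. *)
Definition successive (p : {ffun T -> 'I_#|T|}) : bool :=
  [forall i : 'I_#|T|.+1,
     (1 <= i) ==> induced_connected (initial_segment p i)].

Lemma successiveP (p : {ffun T -> 'I_#|T|}) :
  reflect (forall i : nat, 1 <= i -> induced_connected (initial_segment p i))
          (successive p).
Proof.
apply: (iffP forallP) => [H i i1|H i]; last exact/implyP/H.
have [le_i|lt_i] := leqP i #|T|.
  by have /implyP := H (inord i); rewrite inordK ?ltnS //; apply.
have -> : initial_segment p i = initial_segment p #|T|.
  by apply/setP=> v; rewrite !inE (ltn_ord (p v)) (ltn_trans _ lt_i).
have [T0|T_gt0] := posnP #|T|.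
  by apply/forall_inP=> x; have := fintype0 x T0.
by have /implyP := H ord_max; apply.
Qed.

Definition sigma : nat :=
  #|[set p : {ffun T -> 'I_#|T|} | linear_ordering p & successive p]|.

Definition sigma' : rat := (sigma%:R / (#|T|`!)%:R)%R.

Definition independent (I : {set T}) : bool :=
  [forall x in I, forall y in I, ~~ e x y].

Definition alpha : nat := \max_(I : {set T} | independent I) #|I|.

Definition non_neighbours (I : {set T}) : {set T} :=
  [set v | (v \notin I) && [forall u in I, ~~ e u v]].

(* Independent sets have every size in 0, ..., alpha and no other, so the
   values a k for k > alpha are unconstrained. *)
Definition fully_regular_with (a : nat -> nat) : Prop :=
  forall I : {set T}, independent I -> #|non_neighbours I| = a #|I|.

End Graphs.

(* Main.v *)
Require Import Defs.
From mathcomp Require Import all_boot all_order all_algebra.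
From mathcomp Require Import ring zify.

Set Implicit Arguments.
Unset Strict Implicit.
Unset Printing Implicit Defensive.

Import Order.TTheory GRing.Theory Num.Theory.

(* An ordering is successive iff each vertex but the first is adjacent to an
   earlier one. So the probability P(S) that a random ordering of the vertices
   outside S keeps attaching to what is already there satisfies
   (n - |S|) P(S) = sum of P(S + v) over the v outside S adjacent to S, with
   P(V) = 1. Let m_i(S) be the number of independent i-tuples in the set N(S) of
   vertices neither in S nor adjacent to S. The sum of m_i(S + v) over v in N(S)
   is m_(i+1)(S), and over all v outside S it is m_i(S) (a_i - |S|), as each
   i-tuple leaves a_i vertices free, among them all of S. Hence
   P(S) = sum_i m_i(S) prod_(1 <= j <= i) (-1 / (a_0 - a_j)) solves the
   recurrence, and for S = {v} one has m_i(S) = a_1 ... a_i. *)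

(** * Non-neighbours and independent sets *)

Section IndependentTuples.
Variables (T : finType) (e : rel T).
Hypotheses (e_sym : symmetric e) (e_irr : irreflexive e).

Local Notation N := (non_neighbours e).

Lemma in_non_neighbours1 u v : (v \in N [set u]) = (v != u) && ~~ e u v.
Proof.
rewrite !inE; congr (_ && _); apply/forall_inP/idP => [|Huv w].
  by apply; rewrite inE.
by rewrite inE => /eqP->.
Qed.

Lemma non_neighboursU (A B : {set T}) : N (A :|: B) = N A :&: N B.
Proof.
apply/setP=> v; rewrite !inE negb_or -!andbA; case: (v \in A) => //=.
rewrite [RHS]andbCA; case: (v \in B) => //=.
apply/forall_inP/andP => [H|[/forall_inP HA /forall_inP HB] u].
  by split; apply/forall_inP=> u Hu; apply: H; rewrite inE Hu ?orbT.
by rewrite inE => /orP[/HA|/HB].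
Qed.

Lemma non_neighbours1_sym u v : (v \in N [set u]) = (u \in N [set v]).
Proof. by rewrite !in_non_neighbours1 eq_sym e_sym. Qed.

Lemma non_neighboursP (S : {set T}) v :
  reflect {in S, forall u, v \in N [set u]} (v \in N S).
Proof.
apply: (iffP idP) => [|H].
  rewrite inE => /andP[vS /forall_inP H] u uS.
  by rewrite in_non_neighbours1 H // andbT; apply: contraNneq vS => ->.
rewrite inE; apply/andP; split.
  by apply/negP=> /H; rewrite in_non_neighbours1 eqxx.
by apply/forall_inP=> u /H; rewrite in_non_neighbours1 => /andP[].
Qed.

Lemma sub_non_neighbours_sym (A B : {set T}) :
  (A \subset N B) = (B \subset N A).
Proof.
by apply/subsetP/subsetP=> H u Hu; apply/non_neighboursP=> w Hw;
  rewrite non_neighbours1_sym; apply: (non_neighboursP _ _ (H _ Hw)).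
Qed.

Lemma independent0 : independent e set0.
Proof. by apply/forall_inP=> x; rewrite inE. Qed.

Lemma independentU1 v (S : {set T}) :
  independent e S -> v \in N S -> independent e (v |: S).
Proof.
move=> /forall_inP indS /non_neighboursP vS.
have Hv x : x \in S -> ~~ e x v.
  by move/vS; rewrite in_non_neighbours1 => /andP[].
apply/forall_inP=> x /setU1P[->|xS]; apply/forall_inP=> y /setU1P[->|yS].
- by rewrite e_irr.
- by rewrite e_sym Hv.
- exact: Hv.
- exact: (forall_inP (indS _ xS)).
Qed.

Lemma notin_non_neighbours v (S : {set T}) : v \in N S -> v \notin S.
Proof. by rewrite inE => /andP[]. Qed.

Lemma independent_card_le (I : {set T}) : independent e I -> #|I| <= alpha e.
Proof. by move=> HI; rewrite /alpha (bigD1 I) //= leq_maxl. Qed.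

(* The number of [i]-tuples of distinct pairwise non-adjacent vertices, all
   taken in [non_neighbours e S]. *)
Fixpoint indep_tuples (i : nat) (S : {set T}) : nat :=
  if i is j.+1 then \sum_(v in N S) indep_tuples j (v |: S) else 1.

(** Turns a nonzero count into an actual independent set; this bounds [i] by [alpha e] and keeps the
    denominators nonzero. *)
Lemma indep_tuples_gt0 i (S : {set T}) : 0 < indep_tuples i S ->
  exists I : {set T}, [/\ independent e I, #|I| = i & I \subset N S].
Proof.
elim: i S => [|i IH] S /=.
  by exists set0; rewrite independent0 cards0 sub0set.
rewrite lt0n sum_nat_eq0 negb_forall_in => /exists_inP[v vS].
rewrite -lt0n => /IH[I [indI cI]].
rewrite non_neighboursU subsetI => /andP[IvN ISN].
have vI : v \in N I.
  by rewrite -sub1set sub_non_neighbours_sym.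
exists (v |: I); split.
- exact: independentU1.
- by rewrite cardsU1 (notin_non_neighbours vI) cI.
- by rewrite subUset sub1set vS.
Qed.

(** * Tuple counts in a fully regular graph *)

Variable a : nat -> nat.
Hypothesis G_reg : fully_regular_with e a.

Lemma fully_regular_a0 : a 0 = #|T|.
Proof.
rewrite -(cards0 T) -G_reg ?independent0 // -cardsT; apply: eq_card => v.
by rewrite [RHS]inE; apply/non_neighboursP=> u; rewrite inE.
Qed.

(** A nonempty independent set is disjoint from its own non-neighbours, so these are not all of
    [T]. *)
Lemma indep_tuples_gt0_lt i (S : {set T}) :
  0 < i -> 0 < indep_tuples i S -> a i < a 0.
Proof.
move=> i0 /indep_tuples_gt0[I [indI cI _]].
rewrite -cI -G_reg // fully_regular_a0 -cardsT; apply: proper_card.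
have /card_gt0P[x xI] : 0 < #|I| by rewrite cI.
apply/properP; split; first exact: subsetT.
by exists x => //; apply: contraL xI => /notin_non_neighbours.
Qed.

(** Each chosen vertex keeps the set independent and enlarges it by one, so regularity fixes the
    number of choices at every step. *)
Lemma indep_tuples_independent i (S : {set T}) : independent e S ->
  indep_tuples i S = \prod_(0 <= j < i) a (#|S| + j).
Proof.
elim: i S => [|i IH] S indS /=; first by rewrite big_geq.
rewrite big_nat_recl // addn0 -G_reg // -sum_nat_const.
apply: eq_bigr => v vS; rewrite IH ?independentU1 //.
by rewrite cardsU1 (notin_non_neighbours vS); under eq_bigr do rewrite addSnnS.
Qed.

(* Choosing the tuple before [v] moves its vertices into [J] one at a time, and
   the number of possible [v] only depends on the final size of [J]. *)
Lemma sum_indep_tuplesU i (S J : {set T}) : independent e J -> J \subset N S ->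
  \sum_(v in N J :\: S) indep_tuples i (v |: (S :|: J))
    + indep_tuples i (S :|: J) * #|S|
  = indep_tuples i (S :|: J) * a (i + #|J|).
Proof.
elim: i J => [|i IH] J indJ JS.
  rewrite /= !mul1n add0n sum1_card -G_reg // addnC.
  move: JS; rewrite sub_non_neighbours_sym => /setIidPr SN.
  by rewrite -{1}SN cardsID.
rewrite /= (exchange_big_dep (mem (N (S :|: J)))) /=; last first.
  by move=> v u _; rewrite non_neighboursU => /setIP[].
rewrite !big_distrl -big_split /=; apply: eq_bigr => u uSJ.
have [uS uJ] : u \in N S /\ u \in N J by apply/setIP; rewrite -non_neighboursU.
have indJ' := independentU1 indJ uJ.
have JS' : u |: J \subset N S by rewrite subUset sub1set uS.
have := IH _ indJ' JS'.
rewrite cardsU1 (notin_non_neighbours uJ) addnA addn1 setUCA => <-.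
congr (_ + _); apply: eq_big => [v|v _]; last by rewrite setUCA.
(* [u] stays free after adding [v] iff [v] is free of [u], so the swapped condition on [v] is the
   one in the induction hypothesis for [u |: J]. *)
rewrite !non_neighboursU !in_setD !in_setI (non_neighbours1_sym v u).
move: uSJ; rewrite non_neighboursU in_setI => ->.
by rewrite andbT -andbA [X in _ && X]andbC.
Qed.

Lemma sum_indep_tuplesC i (S : {set T}) :
  \sum_(v in ~: S) indep_tuples i (v |: S) + indep_tuples i S * #|S|
  = indep_tuples i S * a i.
Proof.
have := @sum_indep_tuplesU i S _ independent0 (sub0set _).
rewrite setU0 cards0 addn0 => <-; congr (_ + _); apply: eq_bigl => v.
rewrite in_setD in_setC (_ : v \in N set0) ?andbT //.
by apply/non_neighboursP=> u; rewrite inE.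
Qed.

(** * The recurrence for the completion probability *)

Local Open Scope ring_scope.

Arguments indep_tuples : simpl never.

(** The numerators [a j] of the final product are left out: they come from the tuple counts at a
    single vertex. *)
Definition weight (i : nat) : rat :=
  \prod_(1 <= j < i.+1) (-1 / ((a 0%N)%:R - (a j)%:R)).

(* [completion_prob S] is the probability that a uniformly random ordering of
   the complement of [S] continues [S] successively. *)
Definition completion_prob (S : {set T}) : rat :=
  \sum_(0 <= i < (alpha e).+1) weight i * (indep_tuples i S)%:R.

Lemma indep_tuples_gt_alpha i (S : {set T}) :
  (alpha e < i)%N -> indep_tuples i S = 0%N.
Proof.
move=> lt_i; apply/eqP; rewrite -leqn0 leqNgt; apply/negP.
by case/indep_tuples_gt0=> I [/independent_card_le le_I cI _]; lia.
Qed.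

(** If [S] admits no such tuple, both sides are 0; otherwise the new denominator is nonzero and
    cancels. *)
Lemma weightS i (S : {set T}) :
  weight i * (indep_tuples i.+1 S)%:R =
  - weight i.+1 * (indep_tuples i.+1 S)%:R * ((a 0%N)%:R - (a i.+1)%:R).
Proof.
have [->|] := posnP (indep_tuples i.+1 S); first by rewrite !mulr0 mul0r.
move=> /(indep_tuples_gt0_lt (ltn0Sn i)) lt_a.
have -> : weight i.+1 = weight i * (-1 / ((a 0%N)%:R - (a i.+1)%:R)).
  by rewrite /weight big_nat_recr.
field.
by rewrite subr_eq0 eqr_nat; apply/eqP; lia.
Qed.

Lemma completion_probE (S : {set T}) :
  \sum_(v in ~: S :\: N S) completion_prob (v |: S)
  = (#|T| - #|S|)%:R * completion_prob S.
Proof.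
have NS : N S \subset ~: S.
  by apply/subsetP=> v /notin_non_neighbours; rewrite inE.
have splitS (F : T -> rat) : \sum_(v in ~: S :\: N S) F v =
    \sum_(v in ~: S) F v - \sum_(v in N S) F v.
  by rewrite [X in _ = X - _](big_setID (N S)) /= (setIidPr NS) addrC addrK.
have sumC i : \sum_(v in ~: S) (indep_tuples i (v |: S))%:R =
    (indep_tuples i S)%:R * ((a i)%:R - #|S|%:R) :> rat.
  by rewrite mulrBr -!natrM -sum_indep_tuplesC natrD addrK natr_sum.
have sumN i : \sum_(v in N S) (indep_tuples i (v |: S))%:R =
    (indep_tuples i.+1 S)%:R :> rat.
  by rewrite -natr_sum.
rewrite splitS /completion_prob ![\sum_(v in _) \sum_(_ <= _ < _) _]exchange_big /=.
under eq_bigr do rewrite -mulr_sumr sumC.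
under [X in _ - X]eq_bigr do rewrite -mulr_sumr sumN weightS.
rewrite [X in _ - X]big_nat_recr //= indep_tuples_gt_alpha // mulr0 mul0r addr0.
rewrite natrB ?max_card // -fully_regular_a0 mulr_sumr.
(* For [i > 0] the factors [a i - #|S|] and, from the shifted sum, [a 0 - a i] add up to
   [a 0 - #|S|]; the term [i = 0] has this factor already. *)
rewrite !big_nat_recl //= -addrA -sumrB; congr (_ + _); first by ring.
by apply: eq_bigr => i _; ring.
Qed.

End IndependentTuples.

(** * Successive orderings as attachment to earlier vertices *)

Section SuccessiveOrderings.
Variables (T : finType) (e : rel T).
Hypotheses (e_sym : symmetric e) (e_irr : irreflexive e).

Local Notation N := (non_neighbours e).
Local Notation ordering := {ffun T -> 'I_#|T|}.

Lemma induced_connectedU1 v (S : {set T}) : induced_connected e S ->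
  v \notin N S -> induced_connected e (v |: S).
Proof.
move=> conS vNS; have [/setUidPr ->//|] := boolP ([set v] \subset S).
rewrite sub1set => vS.
move: vNS; rewrite inE vS negb_forall_in /= => /exists_inP[u uS /negPn euv].
have ind_sym (A : {set T}) : symmetric (induced e A).
  by move=> x y; rewrite /induced /= e_sym andbCA.
have con_v x : x \in v |: S -> connect (induced e (v |: S)) x u.
  case/setU1P=> [->|xS].
    by apply: connect1; rewrite /induced /= !inE eqxx uS orbT e_sym.
  have := forall_inP (forall_inP conS x xS) u uS; apply: connect_sub => y z.
  by case/and3P=> yS zS eyz; apply: connect1; rewrite /induced /= !inE yS zS eyz !orbT.
apply/forall_inP=> x /con_v xu; apply/forall_inP=> y /con_v yu.
by apply: connect_trans xu _; rewrite (sym_connect_sym (ind_sym _)).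
Qed.

(** A path from [v] to [u] must start with an edge from [v] into [S]. *)
Lemma induced_connected_attached u v (S : {set T}) :
  induced_connected e (v |: S) -> u \in S -> v \notin N S.
Proof.
move=> con uS; apply/negP=> vN; have vS := notin_non_neighbours vN.
have := forall_inP (forall_inP con v (setU11 _ _)) u (setU1r _ uS).
case/connectP=> -[|w q] /=; first by move=> _ Eu; rewrite -Eu uS in vS.
case/andP=> /and3P[_ /setU1P[->|wS] evw] _ _; first by rewrite e_irr in evw.
move/non_neighboursP/(_ _ wS): vN.
by rewrite in_non_neighbours1 e_sym evw andbF.
Qed.

Lemma ordering_surj (p : ordering) k :
  linear_ordering p -> k < #|T| -> exists v, p v = k :> nat.
Proof.
move=> /injectiveP inj_p lt_k.
have /codomP[v Ev] : Ordinal lt_k \in codom p.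
  by apply: inj_card_onto; rewrite ?card_ord.
by exists v; rewrite -Ev.
Qed.

Lemma initial_segmentS (p : ordering) v : linear_ordering p ->
  initial_segment p (p v).+1 = v |: initial_segment p (p v).
Proof.
move=> /injectiveP inj_p; apply/setP=> u.
by rewrite !inE ltnS leq_eqVlt -(inj_eq inj_p).
Qed.

(** Positions start at 0, so [initial_segment p (p v)] holds the vertices strictly before [v], and
    lying outside [N] of it means having an earlier neighbour. *)
Definition attached_from (k : nat) (p : ordering) : bool :=
  [forall v, (k <= p v) ==> (v \notin N (initial_segment p (p v)))].

Lemma successive_attached (p : ordering) :
  linear_ordering p -> successive e p = attached_from 1 p.
Proof.
move=> lin_p; apply/successiveP/forall_inP => [suc v pv|att].
  have [u pu] := ordering_surj lin_p (leq_ltn_trans (leq0n _) (ltn_ord (p v))).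
  apply: (@induced_connected_attached u).
    by rewrite -initial_segmentS //; apply: suc.
  by rewrite inE pu.
elim=> // -[|i] IH _.
  apply/forall_inP=> x; rewrite inE ltnS leqn0 => /eqP px.
  apply/forall_inP=> y; rewrite inE ltnS leqn0 => /eqP py.
  by rewrite (_ : x = y) //; apply/(injectiveP _ lin_p)/val_inj; rewrite /= px.
have [/(ordering_surj lin_p)[v pv]|le_i] := ltnP i.+1 #|T|.
  rewrite -pv initial_segmentS //; apply: induced_connectedU1.
    by rewrite pv; apply: IH.
  by apply: att; rewrite pv.
(* Past the last position the segments no longer grow. *)
rewrite (_ : initial_segment p i.+2 = initial_segment p i.+1) ?IH //.
by apply/setP=> v; rewrite !inE; have := ltn_ord (p v); lia.
Qed.

(** * Counting orderings with a prescribed beginning *)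

Definition begins_with (s : seq T) (p : ordering) : bool :=
  map (fun v => nat_of_ord (p v)) s == iota 0 (size s).

(* The orderings that list [s] first and attach each later vertex to an earlier
   one; nothing is required of the vertices of [s] among themselves. *)
Definition attached_extensions (s : seq T) : {set ordering} :=
  [set p | [&& linear_ordering p, begins_with s p & attached_from (size s) p]].

Lemma begins_with_rcons s v p : begins_with (rcons s v) p =
  begins_with s p && (p v == size s :> nat).
Proof.
by rewrite /begins_with map_rcons size_rcons -addn1 iotaD add0n cats1 eqseq_rcons.
Qed.

Lemma begins_with_segment s p : linear_ordering p -> begins_with s p ->
  initial_segment p (size s) = [set v in s].
Proof.
move=> /injectiveP inj_p /eqP Es; apply/setP=> v; rewrite !inE.
rewrite -[RHS](mem_map (f := fun v => nat_of_ord (p v))) ?Es ?mem_iota //.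
by move=> x y /val_inj /inj_p.
Qed.

Lemma attached_fromS k v p : linear_ordering p -> p v = k :> nat ->
  attached_from k p = (v \notin N (initial_segment p k)) && attached_from k.+1 p.
Proof.
move=> /injectiveP inj_p pv; apply/forall_inP/andP => [att|[vN /forall_inP att] u].
  split; first by rewrite -pv; apply: att; rewrite pv.
  by apply/forall_inP=> u /ltnW; apply: att.
rewrite leq_eqVlt => /orP[/eqP pu|/att//].
by rewrite -pu (_ : u = v) //; apply/inj_p/val_inj; rewrite /= pv.
Qed.

(** Sorts the orderings by the vertex at position [size s], which is new and attached to [s]. *)
Lemma card_attached_extensionsS s : size s < #|T| ->
  #|attached_extensions s| =
  \sum_(v in ~: [set x in s] :\: N [set x in s]) #|attached_extensions (rcons s v)|.
Proof.
move=> lt_s; rewrite -sum1_card.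
under [RHS]eq_bigr => v _ do rewrite -sum1_card.
rewrite (exchange_big_dep (mem (attached_extensions s))) /=; last first.
  move=> v p; rewrite in_setD => /andP[vN _].
  rewrite !inE begins_with_rcons size_rcons => /and3P[lin_p /andP[beg /eqP pv] att].
  rewrite lin_p beg (attached_fromS lin_p pv) att andbT /=.
  by rewrite begins_with_segment.
apply: eq_bigr => p; rewrite inE => /and3P[lin_p beg att].
have [v pv] := ordering_surj lin_p lt_s.
rewrite (big_pred1 v) // => u /=.
rewrite in_setD [p \in _]inE begins_with_rcons size_rcons lin_p beg /=.
apply/idP/eqP => [/and3P[_ /eqP pu _]|->].
  by apply: (injectiveP _ lin_p); apply: val_inj; rewrite /= pu.
move: att; rewrite (attached_fromS lin_p pv) -(begins_with_segment lin_p beg) => /andP[-> ->].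
by rewrite pv eqxx in_setC inE pv ltnn.
Qed.

Lemma card_attached_extensions_full s : uniq s -> size s = #|T| ->
  #|attached_extensions s| = 1%N.
Proof.
move=> uniq_s size_s.
have mem_s v : v \in s.
  have /subset_cardP := etrans (card_uniqP uniq_s) size_s.
  by move/(_ (subset_predT _)) => ->.
have lt_s v : index v s < #|T| by rewrite -size_s index_mem.
(* The only candidate: each vertex is placed at its index in [s]. *)
pose p : ordering := [ffun v => Ordinal (lt_s v)].
apply/eqP/cards1P; exists p; apply/setP=> q; rewrite !inE.
have begP r : begins_with s r -> r = p.
  move/eqP=> Es; apply/ffunP=> v; apply: val_inj; rewrite ffunE /=.
  have := congr1 (nth 0%N ^~ (index v s)) Es.
  rewrite (nth_map v) ?index_mem // nth_index //.
  by rewrite nth_iota ?index_mem.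
apply/and3P/eqP => [[_ /begP //]|->]; split.
- apply/injectiveP=> x y; rewrite !ffunE => -[] /(congr1 (nth x s)).
  by rewrite !nth_index.
- apply/eqP/(@eq_from_nth _ 0%N); first by rewrite size_map size_iota.
  move=> i; rewrite size_map => lt_i; have /card_gt0P[x _] : 0 < #|T| by lia.
  by rewrite (nth_map x) // nth_iota // ffunE /= index_uniq.
- by apply/forall_inP=> v; rewrite size_s leqNgt ltn_ord.
Qed.

(** Sorts the successive orderings by their first vertex, the only one exempt from attaching. *)
Lemma sigma_attached_extensions : 0 < #|T| ->
  sigma e = \sum_v #|attached_extensions [:: v]|.
Proof.
move=> T_gt0; rewrite /sigma -sum1_card.
under [RHS]eq_bigr => v _ do rewrite -sum1_card.
rewrite (exchange_big_dep (fun p => linear_ordering p && successive e p)) /=.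
  rewrite (eq_bigl _ _ (fun p => in_set _ p)) /=; apply: eq_bigr => p /andP[lin_p].
  rewrite successive_attached // => att.
  have [v pv] := ordering_surj lin_p T_gt0.
  rewrite (big_pred1 v) // => u /=; rewrite inE lin_p att andbT /begins_with /=.
  rewrite eqseq_cons andbT -(inj_eq (injectiveP _ lin_p)).
  by rewrite -pv.
move=> v p _; rewrite inE => /and3P[lin_p _ att].
by rewrite lin_p successive_attached.
Qed.

(** * The closed formula *)

Variable a : nat -> nat.
Hypothesis G_reg : fully_regular_with e a.

Local Open Scope ring_scope.

(** No vertex lies outside [setT], so only the empty tuple contributes. *)
Lemma completion_probT : completion_prob e a setT = 1.
Proof.
rewrite /completion_prob big_nat_recl //= {1}/weight big_geq // mulr1.
rewrite big1_seq ?addr0 // => i _; rewrite [X in _ * X%:R]big_pred0 ?mulr0 // => v.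
by apply: contraTF (in_setT v) => /notin_non_neighbours.
Qed.

Lemma completion_prob1 v : completion_prob e a [set v] =
  \sum_(0 <= i < (alpha e).+1)
    \prod_(1 <= j < i.+1) (- (a j)%:R / ((a 0%N)%:R - (a j)%:R)).
Proof.
have indv : independent e [set v].
  rewrite -[[set v]]setU0; apply: independentU1 => //; first exact: independent0.
  by apply/non_neighboursP=> u; rewrite inE.
apply: eq_bigr => i _; rewrite (indep_tuples_independent e_sym e_irr G_reg) // cards1.
rewrite /weight !big_add1 /= natr_prod -big_split; apply: eq_bigr => j _ /=.
by rewrite add1n mulrAC mulN1r.
Qed.

(** Induction on the number of vertices left: the factorial absorbs the factor [#|T| - #|S|] of
    [completion_probE], so both sides obey the same recurrence. *)
Lemma card_attached_extensions s : uniq s ->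
  #|attached_extensions s|%:R =
  ((#|T| - size s)`!)%:R * completion_prob e a [set x in s].
Proof.
move En: (#|T| - size s)%N => n; elim: n s En => [|n IH] s En uniq_s.
all: have card_s : #|[set x in s]| = size s by rewrite cardsE; apply/card_uniqP.
  have le_s : (size s <= #|T|)%N by rewrite -card_s max_card.
  rewrite card_attached_extensions_full //; last by lia.
  rewrite (_ : [set x in s] = setT) ?completion_probT ?mulr1 //.
  by apply/eqP; rewrite eqEcard subsetT cardsT card_s -subn_eq0 En.
rewrite card_attached_extensionsS; last by rewrite -subn_gt0 En.
rewrite natr_sum factS mulnC natrM -mulrA -En -card_s.
rewrite -(completion_probE e_sym e_irr G_reg) mulr_sumr; apply: eq_bigr => v.
rewrite in_setD in_setC inE => /andP[_ vs].
rewrite IH ?rcons_uniq ?vs //; last by rewrite size_rcons subnS En.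
by congr (_ * completion_prob e a _); apply/setP=> x; rewrite !inE mem_rcons inE.
Qed.

Lemma sigmaE : (sigma e)%:R = (#|T|`!)%:R *
  \sum_(0 <= i < (alpha e).+1)
    \prod_(1 <= j < i.+1) (- (a j)%:R / ((a 0%N)%:R - (a j)%:R)) :> rat.
Proof.
(* Without vertices there is no first vertex to sort by, and the empty list serves instead. *)
have [T0|T_gt0] := posnP #|T|.
  have noT (v : T) : False by have := fintype0 v T0.
  rewrite (_ : sigma e = #|attached_extensions [::]|).
    rewrite card_attached_extensions // subn0; congr (_ * _).
    rewrite (_ : [set x in [::]] = setT); last by apply/setP=> v; case: (noT v).
    rewrite completion_probT (_ : alpha e = 0%N) ?big_nat1 ?big_geq //.
    by apply/eqP; rewrite -leqn0 -T0; apply/bigmax_leqP=> I _; apply: max_card.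
  apply: eq_card => p; rewrite !inE; case lin_p: (linear_ordering p) => //=.
  rewrite successive_attached // /begins_with /=.
  by apply/forallP/forallP=> _ v; case: (noT v).
rewrite sigma_attached_extensions // natr_sum.
(* All [#|T|] first vertices contribute the same amount, which turns the factorial of [#|T| - 1]
   into that of [#|T|]. *)
under eq_bigr => v _ do
  rewrite card_attached_extensions // set_seq1 completion_prob1.
rewrite /= sumr_const -mulrnAl -mulrnA; congr (_%:R * _).
by rewrite subn1 mulnC -[in RHS](prednK T_gt0) factS prednK.
Qed.

End SuccessiveOrderings.

Local Open Scope ring_scope.

Theorem theorem2 (T : finType) (e : rel T) (e_sym : symmetric e)
  (e_irr : irreflexive e) (a : nat -> nat)
  (G_reg : fully_regular_with e a) :
  sigma' e = \sum_(0 <= i < (alpha e).+1)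
               \prod_(1 <= j < i.+1) (- (a j)%:R / ((a 0%N)%:R - (a j)%:R))
  /\
  (sigma e)%:R = ((a 0%N)`!)%:R *
             (\sum_(0 <= i < (alpha e).+1)
               \prod_(1 <= j < i.+1)
                 (- (a j)%:R / ((a 0%N)%:R - (a j)%:R))) :> rat.
Proof.
rewrite /sigma' (sigmaE e_sym e_irr G_reg) mulrAC divff ?mul1r; last first.
  by rewrite pnatr_eq0 -lt0n fact_gt0.
by split; rewrite // -(fully_regular_a0 G_reg).
Qed.
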